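(* Let $k\in\{1,2,\ldots\}$ and let $\sigma:\mathbb{R}\to\mathbb{R}$ be a $k$-sigmoidal function. Then the linear subspace $H_{\sigma}(\mathbb{R})$ is dense in $\mathcal{Y}_k(\mathbb{R})$ with respect to the norm $\|\cdot\|_{\mathcal{Y}_k}$.
   Context: Functions in $\mathcal{Y}_k(\mathbb{R})$ are complex-valued and linear spans are taken over $\mathbb{C}$. A continuous function $\sigma:\mathbb{R}\to\mathbb{R}$ is called $k$-sigmoidal if $$\lim_{x\to-\infty}\frac{\sigma(x)}{x^k}=0,\qquad \lim_{x\to\infty}\frac{\sigma(x)}{x^k}=1.$$ $\mathcal{Y}_k(\mathbb{R})$ is the space of all continuous functions $f$ on $\mathbb{R}$ for which both limits $\lim_{x\to\infty}\frac{f(x)}{1+|x|^k}$ and $\lim_{x\to-\infty}\frac{f(x)}{1+|x|^k}$ exist (as finite numbers, not necessarily equal), equipped with the norm $$\|f\|_{\mathcal{Y}_k}=\sup_{x\in\mathbb{R}}\frac{|f(x)|}{1+|x|^k}.$$ $H_{\sigma}(\mathbb{R})$ is the linear span of the functions $x\mapsto \sigma(ax+b)$ with $a,b\in\mathbb{R}$, $a\neq 0$. *)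

(* Defs.v *)
From HB Require Import structures.
From mathcomp Require Import all_boot all_order all_algebra.
From mathcomp Require Import all_classical all_reals all_analysis.
From mathcomp Require Import complex.

Set Implicit Arguments.
Unset Strict Implicit.
Unset Printing Implicit Defensive.

Import Order.TTheory GRing.Theory Num.Theory numFieldNormedType.Exports.
Import Normc.

Local Open Scope classical_set_scope.
Local Open Scope complex_scope.
Local Open Scope ring_scope.

(* The regular module [R[i]^o] carries the topology of the complex modulus,   *)
(* whose library version [`|z|] lives in [R[i]]; [normc z] is the same number *)
(* in [R] (see [normcEr]).                                                    *)

Section weighted_space.
Variables (R : realType) (k : nat).
Implicit Types (f g : R -> R[i]^o) (x : R).

Definition weight x : R := 1 + `|x| ^+ k.

Definition weighted f : R -> R[i]^o := fun x => f x / (weight x)%:C.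

Definition inY f : Prop :=
  [/\ continuous f,
      exists l : R[i]^o, weighted f x @[x --> +oo] --> l &
      exists l : R[i]^o, weighted f x @[x --> -oo] --> l].

Definition Ymem : {pred R -> R[i]^o} := [pred f | `[< inY f >]].

(* [sup] is 0 on unbounded sets, but the set below is always bounded when     *)
(* [inY f] (see [Ynorm_has_sup]).                                             *)
Definition Ynorm f : R := sup (range (fun x => normc (f x) / weight x)).

Lemma weight_gt0 x : 0 < weight x.
Proof. by rewrite ltr_wpDr// exprn_ge0. Qed.

Lemma normcEr (z : R[i]) : `|z| = (normc z)%:C.
Proof. by rewrite normc_def; case: z. Qed.

Lemma normc_nneg (z : R[i]) : 0 <= normc z.
Proof. by case: z => a b; exact: sqrtr_ge0. Qed.

Lemma normc_weighted f x : normc (weighted f x) = normc (f x) / weight x.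
Proof.
apply: (@complexI R); rewrite -normcEr normrM normfV normcEr rmorphM fmorphV/=.
congr (_ / _); rewrite ger0_norm// lecR; exact/ltW/weight_gt0.
Qed.

Lemma continuous_normc : continuous (@normc R : R[i]^o -> R).
Proof.
move=> z; apply/(@cvgrPdist_lt _ _ _ (nbhs (z : R[i]^o))) => e e0.
have e0' : 0 < e%:C :> R[i] by rewrite ltcR.
have : \forall w \near nbhs (z : R[i]^o), ball_ Num.norm z e%:C w.
  by apply/nbhs_ballP; exists e%:C => // w; rewrite -ball_normE.
apply: filterS => w; rewrite /ball_/= normcEr ltcR; apply: le_lt_trans.
have D (a b : R[i]) : normc a - normc b <= normc (a - b).
  by rewrite lerBlDr (le_trans _ (le_normcD _ _))// subrK.
by rewrite ler_norml D andbT lerNl opprB (le_trans (D _ _))// -normcN opprB.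
Qed.

Lemma continuous_weight : continuous weight.
Proof.
move=> x; apply: cvgD; first exact: cvg_cst.
by apply: (@cvg_comp _ _ _ (fun x : R => `|x|) (fun y : R => y ^+ k) _ (nbhs `|x|));
  [exact: norm_continuous|exact: exprn_continuous].
Qed.

Lemma inY_bounded f : inY f ->
  exists M, forall x, normc (f x) / weight x <= M.
Proof.
case=> cf [l fl] [m fm].
pose h x := normc (f x) / weight x.
have hE x : h x = normc (weighted f x) by rewrite normc_weighted.
have ch : continuous h.
  move=> x; apply: cvgM.
    by apply: (@cvg_comp _ _ _ f _ _ (nbhs (f x))); [exact: cf|exact: continuous_normc].
  by apply: cvgV; [rewrite gt_eqF// weight_gt0|exact: continuous_weight].
have bd (F : set_system R) (a : R[i]^o) : Filter F ->
    weighted f x @[x --> F] --> a -> \forall x \near F, h x <= normc a + 1.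
  move=> FF fa.
  have : normc (weighted f x) @[x --> F] --> normc a.
    by apply: (@cvg_comp _ _ _ _ _ _ (nbhs a)) fa _; exact: continuous_normc.
  move=> /cvgrPdist_lt /(_ 1 ltr01); apply: filterS => x.
  rewrite hE distrC => /ltW/(le_trans (ler_norm _)).
  by rewrite lerBlDl.
have [A [_ HA]] := bd _ _ _ fl.
have [B [_ HB]] := bd _ _ _ fm.
pose a := Num.min (B - 1) (A + 1); pose b := A + 1.
have ab : a <= b by rewrite ge_min lexx orbT.
have [c _ hc] := @EVT_max R h a b ab (continuous_subspaceT ch).
exists (Num.max (h c) (Num.max (normc l + 1) (normc m + 1))) => x.
rewrite -/(h x) !le_max.
have [xa|ax] := ltP x a.
  by rewrite HB ?orbT// (lt_le_trans xa)// ge_min lerBlDr lerDl ler01.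
have [bx|xb] := ltP b x.
  by rewrite HA ?orbT// (le_lt_trans _ bx)// lerDl.
by rewrite hc// in_itv/= ax xb.
Qed.

Lemma Ymem_submod_closed : submod_closed Ymem.
Proof.
have w0 : weighted 0 = cst 0 by apply/funext => x; rewrite /weighted mul0r.
have wD a f g :
    weighted (a *: f + g) = fun x => a *: weighted f x + weighted g x.
  apply/funext => x.
  transitivity ((a * f x + g x) / (weight x)%:C : R[i]) => //.
  by rewrite mulrDl -mulrA.
have cvgw (F : set_system R) a f g : Filter F ->
    (exists l : R[i]^o, weighted f x @[x --> F] --> l) ->
    (exists l : R[i]^o, weighted g x @[x --> F] --> l) ->
    exists l : R[i]^o, weighted (a *: f + g) x @[x --> F] --> l.
  move=> FF [l fl] [m gm]; exists (a *: l + m); rewrite wD.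
  by apply: (@cvgD _ _ _ F) gm; apply: (@cvgZr _ _ _ F).
split.
  apply/asboolP; split; [exact: cst_continuous | | ];
    by exists 0; rewrite w0; exact: cvg_cst.
move=> a f g /asboolP[cf fp fm] /asboolP[cg gp gm]; apply/asboolP; split.
- move=> x; apply: cvgD; last exact: cg.
  by apply: cvgZr; exact: cf.
- exact: cvgw.
- exact: cvgw.
Qed.

HB.instance Definition _ :=
  GRing.isSubmodClosed.Build R[i] (R -> R[i]^o) Ymem Ymem_submod_closed.

(* Bundled so that the canonical topology of [Yspace R k] is the one of the   *)
(* norm [Ynorm] (see [YnormE]) and not one inherited from a function space.   *)
Record Yspace := MkYspace { Yfun :> R -> R[i]^o; _ : Yfun \in Ymem }.

HB.instance Definition _ := [isSub for Yfun].
HB.instance Definition _ := [Choice of Yspace by <:].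
HB.instance Definition _ := [SubChoice_isSubLmodule of Yspace by <:].

Lemma YP (f : Yspace) : inY f.
Proof. by case: f => f /= /asboolP. Qed.

Lemma Ynorm_has_sup f : inY f ->
  has_sup (range (fun x => normc (f x) / weight x)).
Proof.
move=> /inY_bounded[M fM]; split; first by exists (normc (f 0) / weight 0), 0.
by exists M => _ [x _ <-].
Qed.

Lemma Ynorm_ub f x : inY f -> normc (f x) / weight x <= Ynorm f.
Proof. by move=> /Ynorm_has_sup [_ h]; apply: ub_le_sup => //; exists x. Qed.

Lemma Ynorm_ge0 f : inY f -> 0 <= Ynorm f.
Proof.
move=> fY; apply: le_trans (Ynorm_ub 0 fY).
by rewrite divr_ge0 ?normc_nneg ?ltW ?weight_gt0.
Qed.

Lemma Ynorm_le f M : (forall x, normc (f x) / weight x <= M) -> Ynorm f <= M.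
Proof.
move=> fM; apply: ge_sup; first by exists (normc (f 0) / weight 0), 0.
by move=> _ [x _ <-].
Qed.

Let Ynorm_subproof_le (f g : Yspace) :
  (Ynorm (f + g : Yspace))%:C <= (Ynorm f)%:C + (Ynorm g)%:C :> R[i].
Proof.
rewrite -rmorphD lecR; apply: Ynorm_le => x.
apply: le_trans (lerD (Ynorm_ub x (YP f)) (Ynorm_ub x (YP g))).
rewrite -mulrDl ler_pM2r ?invr_gt0 ?weight_gt0//; exact: le_normcD.
Qed.

Let Ynorm_subproof_Z (l : R[i]) (f : Yspace) :
  (Ynorm (l *: f : Yspace))%:C = `|l| * (Ynorm f)%:C :> R[i].
Proof.
rewrite normcEr -rmorphM; congr (_%:C).
have le (a : R[i]) (g : Yspace) : Ynorm (a *: g : Yspace) <= normc a * Ynorm g.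
  apply: Ynorm_le => x; rewrite (normcM a (g x)) -mulrA.
  by rewrite ler_wpM2l ?normc_nneg//; exact: Ynorm_ub (YP g).
apply/eqP; rewrite eq_le le/=.
have [->|l0] := eqVneq l 0.
  have -> : normc (0 : R[i]) * Ynorm f = 0 by rewrite [normc _]normc0 mul0r.
  exact: Ynorm_ge0 (YP (0 *: f)).
have nl : 0 < normc l by rewrite -ltcR -normcEr normr_gt0.
rewrite -ler_pdivlMl//.
have := le l^-1 (l *: f); rewrite scalerA mulVf// scale1r => /le_trans; apply.
by rewrite normcV.
Qed.

Let Ynorm_subproof_eq0 (f : Yspace) : (Ynorm f)%:C = 0 :> R[i] -> f = 0.
Proof.
move=> /(@complexI R) f0; apply/val_inj/funext => x /=.
apply: eq0_normc; apply/eqP; rewrite eq_le normc_nneg andbT.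
have := Ynorm_ub x (YP f).
by rewrite f0 pmulr_lle0// invr_gt0 weight_gt0.
Qed.

HB.instance Definition _ := Lmodule_isNormed.Build R[i] Yspace
  Ynorm_subproof_le Ynorm_subproof_Z Ynorm_subproof_eq0.

Lemma YnormE (f : Yspace) : `|f| = (Ynorm f)%:C.
Proof. by []. Qed.

End weighted_space.

Definition sigmoidal (R : realType) (k : nat) (sigma : R -> R) : Prop :=
  [/\ continuous sigma,
      sigma x / x ^+ k @[x --> -oo] --> (0 : R) &
      sigma x / x ^+ k @[x --> +oo] --> (1 : R)].

Definition lspan (K : nzRingType) (V : lmodType K) (A : set V) : set V :=
  [set v | exists (n : nat) (c : 'I_n -> K) (u : 'I_n -> V),
    (forall i, A (u i)) /\ v = \sum_(i < n) c i *: u i].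

Definition ridge (R : realType) (sigma : R -> R) (a b : R) : R -> R[i]^o :=
  fun x => (sigma (a * x + b))%:C.

Definition Hspan (R : realType) (sigma : R -> R) : set (R -> R[i]^o) :=
  lspan [set f | exists a b : R, a != 0 /\ f = ridge sigma a b].

(* Main.v *)
(* Since |sigma y - y_+^k| <= e |y|^k + C, the rescalings sigma (a x) / a^k    *)
(* converge to the truncated power x_+^k in the weighted norm as a -> +oo:    *)
(* the constant C is divided by a^k, which is where k >= 1 is needed.         *)
(* Difference quotients of x_+^(j+1) converge to (j+1) x_+^j, so the closure  *)
(* of the span contains x_+, hence all piecewise linear interpolants with     *)
(* constant ends.  A function of Y_k becomes o(|x|^k) at both ends after      *)
(* subtracting l x_+^k + m (-x)_+^k, and is then approximated by such         *)
(* interpolants on a large segment.                                           *)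
Require Import Defs.
From HB Require Import structures.
From mathcomp Require Import all_boot all_order all_algebra.
From mathcomp Require Import all_classical all_reals all_analysis.
From mathcomp Require Import complex ring lra zify.
Import Order.TTheory GRing.Theory Num.Theory numFieldNormedType.Exports.
Local Open Scope classical_set_scope.
Local Open Scope ring_scope.

(** The argument takes place in the weighted closure of the real functions of the span, the
    predicate [approximable]. It is stable under real linear combinations, weighted limits and
    affine substitutions of nonzero slope, so each function found in it brings along all its
    dilates, translates and reflections. Rescaling [sigma] leaves only its growth, so x_+^k is in
    the closure ([approximable_truncpow]). Differentiating by translation lowers the exponent one at
    a time ([approximable_step_down]) down to x_+ ([approximable_ramp]). Ramps give piecewise linear
    functions, which approximate every continuous function that is o(|x|^k)
    ([approximable_vanishing]). Since x_+^k and its reflection realise any pair of limits at the two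
    ends, [approximable_continuous] reduces every real function of the space to that case.
    [Hspan_approx_inY] then joins real and imaginary parts, while [Hspan_inY] shows that the span
    lies inside the space at all. *)

(** * Linear spans and uniform continuity *)

Section lspan_theory.
Context {K : nzRingType} {V : lmodType K}.
Implicit Types (A : set V) (u v : V).

Lemma lspan_incl A u : A u -> lspan A u.
Proof.
by move=> Au; exists 1%N, (fun=> 1), (fun=> u); rewrite big_ord1 scale1r.
Qed.

Lemma lspanZ A a u : lspan A u -> lspan A (a *: u).
Proof.
move=> [n [c [w [Aw ->]]]]; exists n, (fun i => a * c i), w; split => //.
by rewrite scaler_sumr; apply: eq_bigr => i _; rewrite scalerA.
Qed.

Lemma lspanD A u v : lspan A u -> lspan A v -> lspan A (u + v).
Proof.
move=> [n [c [w [Aw ->]]]] [m [d [z [Az ->]]]].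
pose join T (f : 'I_n -> T) (g : 'I_m -> T) (i : 'I_(n + m)) :=
  match fintype.split i with inl j => f j | inr j => g j end.
exists (n + m)%N, (join K c d), (join V w z); split.
  by move=> i; rewrite /join; case: (fintype.split i).
rewrite big_split_ord/=; congr +%R; apply: eq_bigr => i _; rewrite /join.
  by rewrite (unsplitK (inl i)).
by rewrite (unsplitK (inr i)).
Qed.

End lspan_theory.

(** Compactness of the segment, in its near-covering form, makes the local choice of [d] uniform. *)
Lemma segment_unif_continuous {R : realType} (g : R -> R) (a b e : R) :
  continuous g -> 0 < e ->
  exists2 d, 0 < d &
    forall x y, a <= x <= b -> `|x - y| < d -> `|g x - g y| < e.
Proof.
move=> cg e0.
have /compact_near_coveringP cov := @segment_compact R a b.
have : \forall d \near (0:R)^'+, `[a, b] `<=`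
    [set x | forall y, `|x - y| < d -> `|g x - g y| < e].
  apply: cov => x _.
  have e20 : 0 < e / 2 by rewrite divr_gt0.
  have /cvgrPdist_lt /(_ _ e20) /nbhs_ballP[r /= r0 xr] := cg x.
  (* Half radii: [z] within r/2 of [x] and [y] within r/2 of [z] both lie in the ball of radius [r]
     around [x]. *)
  have r20 : 0 < r / 2 by rewrite divr_gt0.
  exists (ball x (r / 2), [set d | d < r / 2]) => /=.
    split; first exact: nbhsx_ballx.
    exact: nbhs_right_lt.
  move=> [z d] /= [xz dr] y zy.
  have gz : `|g x - g z| < e / 2.
    by apply: xr; apply: le_ball xz; lra.
  have gy : `|g x - g y| < e / 2.
    apply: xr; rewrite /ball/=; move: xz; rewrite /ball/= => xz.
    by have := ler_distD z x y; lra.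
  have := ler_distD (g x) (g z) (g y); rewrite (distrC (g z) (g x)); lra.
move=> /(filterI (nbhs_right_gt 0))/filter_ex[d [d0 ud]].
by exists d => // x y xab; apply: ud.
Qed.

(** * Estimates against the weight *)

Section weight_bounds.
Context {R : realType} (k : nat).
Implicit Types (x a b h : R).

Lemma weight_ge1 x : 1 <= weight k x.
Proof. by rewrite lerDl exprn_ge0. Qed.

Lemma norm_exp_le_weight x : `|x| ^+ k <= weight k x.
Proof. by rewrite lerDr. Qed.

Lemma weightN x : weight k (- x) = weight k x.
Proof. by rewrite /weight normrN. Qed.

Lemma le_weight x y : `|x| <= `|y| -> weight k x <= weight k y.
Proof. by move=> xy; rewrite lerD2l lerXn2r ?nnegrE. Qed.

Lemma exp_1norm_le_weight x j : (j <= k)%N ->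
  (1 + `|x|) ^+ j <= 2 ^+ k * weight k x.
Proof.
move=> jk; have x0 := normr_ge0 x.
apply: (@le_trans _ _ ((1 + `|x|) ^+ k)).
  by apply: ler_weXn2l => //; rewrite lerDl.
have [x1|x1] := leP `|x| 1.
  apply: (@le_trans _ _ (2 ^+ k)).
    by rewrite lerXn2r ?nnegrE ?addr_ge0//; lra.
  by rewrite ler_peMr ?exprn_ge0 ?weight_ge1.
apply: (@le_trans _ _ ((2 * `|x|) ^+ k)).
  by rewrite lerXn2r ?nnegrE ?addr_ge0 ?mulr_ge0//; lra.
by rewrite exprMn ler_wpM2l ?exprn_ge0// norm_exp_le_weight.
Qed.

(** This makes the weighted closure stable under affine substitutions. *)
Lemma weight_affine_le a b : exists2 C, 0 <= C &
  forall x, weight k (a * x + b) <= C * weight k x.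
Proof.
exists (1 + (`|a| + `|b|) ^+ k * 2 ^+ k) => [|x].
  by rewrite addr_ge0 ?mulr_ge0 ?exprn_ge0 ?addr_ge0.
rewrite mulrDl mul1r /weight -/(weight k x) lerD ?weight_ge1//.
rewrite -mulrA.
have ab0 : 0 <= (`|a| + `|b|) ^+ k by rewrite exprn_ge0 ?addr_ge0.
apply: le_trans (ler_wpM2l ab0 (exp_1norm_le_weight x _ (leqnn k))).
rewrite -exprMn lerXn2r ?nnegrE ?mulr_ge0 ?addr_ge0//.
apply: le_trans (ler_normD _ _) _; rewrite normrM.
have := normr_ge0 a; have := normr_ge0 b; have := normr_ge0 x; nra.
Qed.

(** A second-order Taylor remainder, with a crude constant chosen so that the induction closes. *)
Lemma exp_diffquot_le n x h : 0 <= x -> 0 <= h <= 1 ->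
  0 <= (x + h) ^+ n.+1 - x ^+ n.+1 - n.+1%:R * h * x ^+ n
    <= (n.+1 ^ 2)%:R * h ^+ 2 * (1 + x) ^+ n.+1.
Proof.
move=> x0 /andP[h0 h1].
elim: n => [|n /andP[IH0 IH1]].
  rewrite !expr1 expr0; apply/andP; split; first by lra.
  have : 0 <= h ^+ 2 * (1 + x) by rewrite mulr_ge0 ?exprn_ge0//; lra.
  rewrite exp1n; lra.
set E := _ - _ in IH0 IH1.
(* Recursion for the remainder. As x + h <= 1 + x, the constants close up through (n+1) + (n+1)^2 <=
   (n+2)^2. *)
have -> : (x + h) ^+ n.+2 - x ^+ n.+2 - n.+2%:R * h * x ^+ n.+1 =
    n.+1%:R * h ^+ 2 * x ^+ n + (x + h) * E.
  by rewrite /E !exprS -[n.+2]addn1 natrD; ring.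
move: E IH0 IH1 => E IH0 IH1.
have n0 : 0 <= n.+1%:R :> R by [].
apply/andP; split.
  by rewrite addr_ge0 ?mulr_ge0 ?exprn_ge0 ?addr_ge0.
have xn : x ^+ n <= (1 + x) ^+ n.+2.
  apply: (@le_trans _ _ ((1 + x) ^+ n)); first by rewrite lerXn2r ?nnegrE//; lra.
  by apply: ler_weXn2l; [lra|lia].
have xE : (x + h) * E <= (n.+1 ^ 2)%:R * h ^+ 2 * (1 + x) ^+ n.+2.
  rewrite [(1 + x) ^+ n.+2]exprS mulrCA ler_pM ?addr_ge0//; lra.
have nh : 0 <= n.+1%:R * h ^+ 2 by rewrite mulr_ge0 ?exprn_ge0.
apply: le_trans (lerD (ler_wpM2l nh xn) xE) _.
rewrite -mulrDl -mulrDl ler_wpM2r ?exprn_ge0 ?addr_ge0//.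
rewrite ler_wpM2r ?exprn_ge0// -natrD ler_nat.
nia.
Qed.

(** For [0 <= x] this is the Taylor remainder divided by [h]; its factor (1 + x)^(j+1) is dominated
    by the weight because j + 1 <= k. *)
Lemma truncpow_diffquot j : (0 < j)%N -> (j < k)%N -> exists C,
  forall h x, 0 < h <= 1 ->
  `|j.+1%:R * Num.max x 0 ^+ j -
     (Num.max (x + h) 0 ^+ j.+1 - Num.max x 0 ^+ j.+1) / h| <= C * h * weight k x.
Proof.
move=> j0 jk; exists ((j.+1 ^ 2)%:R * 2 ^+ k) => h x /andP[h0 h1].
have w0 : 0 < weight k x by exact: weight_gt0.
have h0w := ltW h0; have w0w := ltW w0.
have hw : h * weight k x <= (j.+1 ^ 2)%:R * 2 ^+ k * h * weight k x.
  rewrite ler_pM2r// ler_peMl// -natrX -natrM ler1n.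
  by rewrite muln_gt0 !expn_gt0.
have [x0|x0] := leP 0 x.
  have hh : 0 <= h <= 1 by apply/andP.
  have /andP[q0 q1] := exp_diffquot_le j x h x0 hh.
  rewrite (max_idPl _) ?addr_ge0//.
  set E := _ - _ in q0 q1.
  have -> : j.+1%:R * x ^+ j - ((x + h) ^+ j.+1 - x ^+ j.+1) / h = - (E / h).
    by rewrite /E; field; rewrite gt_eqF.
  rewrite normrN ger0_norm ?divr_ge0// ler_pdivrMr//.
  apply: le_trans q1 _.
  have := exp_1norm_le_weight x _ jk; rewrite ger0_norm// => xw.
  have c0 : 0 <= (j.+1 ^ 2)%:R * h ^+ 2 :> R by rewrite mulr_ge0 ?exprn_ge0.
  apply: le_trans (ler_wpM2l c0 xw) _.
  by rewrite le_eqVlt; apply/orP; left; apply/eqP; ring.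
(* For [x < 0] only (x + h)_+^(j+1) / h survives; it is at most h^j <= h since [0 < j]. *)
apply: le_trans hw.
rewrite !expr0n !gtn_eqF// mulr0 sub0r subr0 normrN normrM normfV (gtr0_norm h0).
rewrite ler_pdivrMr//.
have m0 : 0 <= Num.max (x + h) 0 by rewrite le_max lexx orbT.
have mh : Num.max (x + h) 0 <= h by rewrite ge_max; lra.
rewrite normrX ger0_norm// exprSr ler_pM ?exprn_ge0//.
apply: (@le_trans _ _ h); last by rewrite ler_peMr ?weight_ge1.
apply: le_trans (lerXn2r _ _ _ mh) _; rewrite ?nnegrE//.
by rewrite -[leRHS]expr1 ler_wiXn2l.
Qed.
End weight_bounds.

(** * The weighted closure of the span, for real functions *)

Section approximation.
Local Open Scope complex_scope.
Context {R : realType} (k : nat) (sigma : R -> R).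
Implicit Types (f g h p : R -> R).

Lemma Hspan_affine (f : R -> R[i]^o) (a b : R) : a != 0 ->
  Hspan sigma f -> Hspan sigma (fun x => f (a * x + b)).
Proof.
move=> a0 [n [c [u [Hu ->]]]].
exists n, c, (fun i x => u i (a * x + b)); split.
  move=> i; have [a' [b' [a'0 ->]]] := Hu i.
  exists (a' * a), (a' * b + b'); split; first by rewrite mulf_neq0.
  by apply/funext => x; rewrite /ridge mulrDr mulrA addrA.
by apply/funext => x; rewrite !fct_sumE.
Qed.

(** Membership in the weighted closure, as a pointwise bound with a real approximant, so that the
    analysis stays in [R]. *)
Definition approximable g := forall e, 0 < e ->
  exists2 h, Hspan sigma (fun x => (h x)%:C) &
    forall x, `|g x - h x| <= e * weight k x.

Lemma Hspan_approximable h : Hspan sigma (fun x => (h x)%:C) -> approximable h.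
Proof.
move=> Hh e e0; exists h => // x.
by rewrite subrr normr0 mulr_ge0 ?ltW ?weight_gt0.
Qed.

(** The closure is closed. The factor [C] absorbs constants of later estimates, and [e <= 1] lets
    [e] itself serve as the step of a difference quotient. *)
Lemma approximable_lim (C : R) g :
  (forall e, 0 < e <= 1 -> exists2 p, approximable p &
     forall x, `|g x - p x| <= C * e * weight k x) ->
  approximable g.
Proof.
move=> H e e0.
(* Using [|C| + 1] keeps the divisor positive and gives C d <= e/2 whatever the sign of [C]. *)
pose d := Num.min 1 (e / 2 / (`|C| + 1)).
have C0 : 0 < `|C| + 1 by rewrite ltr_wpDl.
have d0 : 0 < d by rewrite lt_min ltr01 !divr_gt0.
have [|p Ap gp] := H d; first by rewrite d0 ge_min lexx.
have e20 : 0 < e / 2 by rewrite divr_gt0.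
have [h Hh ph] := Ap _ e20.
exists h => // x.
have w0 : 0 < weight k x by exact: weight_gt0.
have Cd : C * d <= e / 2.
  apply: (@le_trans _ _ ((`|C| + 1) * d)).
    by rewrite ler_pM2r//; have := ler_norm C; lra.
  by rewrite mulrC -ler_pdivlMr// ge_min lexx orbT.
have := ler_distD (p x) (g x) (h x).
have := gp x; have := ph x.
have := ler_wpM2r (ltW w0) Cd; lra.
Qed.

Lemma approximable_comb (a : R) f g :
  approximable f -> approximable g -> approximable (fun x => a * f x + g x).
Proof.
move=> Af Ag; apply: (@approximable_lim (`|a| + 1)) => e /andP[e0 _].
have [h Hh fh] := Af e e0; have [p Hp gp] := Ag e e0.
exists (fun x => a * h x + p x).
  apply: Hspan_approximable.
  have -> : (fun x => (a * h x + p x)%:C) =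
      (a%:C : R[i]) *: (fun x => (h x)%:C : R[i]^o) + (fun x => (p x)%:C).
    by apply/funext => x; rewrite rmorphD rmorphM.
  by apply: lspanD => //; apply: lspanZ.
move=> x.
have -> : a * f x + g x - (a * h x + p x) = a * (f x - h x) + (g x - p x) by ring.
apply: le_trans (ler_normD _ _) _; rewrite normrM 2!mulrDl mul1r lerD//.
by rewrite -mulrA ler_wpM2l.
Qed.

Lemma approximable0 : approximable (fun=> 0).
Proof.
apply: Hspan_approximable; exists 0%N, (fun=> 0), (fun=> 0).
by split=> [[]//|]; rewrite big_ord0.
Qed.

Lemma approximableZ (a : R) f : approximable f -> approximable (fun x => a * f x).
Proof.
move=> Af; have := @approximable_comb a f _ Af approximable0.
by congr approximable; apply/funext => x; rewrite addr0.
Qed.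

Lemma approximableD f g :
  approximable f -> approximable g -> approximable (fun x => f x + g x).
Proof.
move=> Af Ag; have := @approximable_comb 1 f g Af Ag.
by congr approximable; apply/funext => x; rewrite mul1r.
Qed.

Lemma approximableB f g :
  approximable f -> approximable g -> approximable (fun x => f x - g x).
Proof.
move=> Af Ag; have := @approximable_comb (-1) g f Ag Af.
by congr approximable; apply/funext => x; rewrite mulN1r addrC.
Qed.

Lemma approximable_affine (a b : R) g : a != 0 ->
  approximable g -> approximable (fun x => g (a * x + b)).
Proof.
move=> a0 Ag; have [C C0 wC] := @weight_affine_le R k a b.
apply: (@approximable_lim C) => e /andP[e0 _].
have [h Hh gh] := Ag e e0.
exists (fun x => h (a * x + b)).
  by apply: Hspan_approximable; exact: (@Hspan_affine (fun x => (h x)%:C)).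
move=> x; apply: le_trans (gh _) _.
by rewrite [C * e]mulrC -mulrA ler_wpM2l ?(ltW e0).
Qed.

(** The derivative of x_+^(j+1) is (j+1) x_+^j, and its difference quotients are combinations of
    translates. *)
Lemma approximable_step_down j : (0 < j < k)%N ->
  approximable (fun x => Num.max x 0 ^+ j.+1) ->
  approximable (fun x => Num.max x 0 ^+ j).
Proof.
move=> /andP[j0 jk] Aj.
have [C hC] := @truncpow_diffquot R k j j0 jk.
have j10 : j.+1%:R != 0 :> R by rewrite pnatr_eq0.
suff /(@approximableZ j.+1%:R^-1) : approximable (fun x => j.+1%:R * Num.max x 0 ^+ j).
  by congr approximable; apply/funext => x; rewrite mulKf.
apply: (@approximable_lim C) => h h01.
exists (fun x => h^-1 * (Num.max (x + h) 0 ^+ j.+1 - Num.max x 0 ^+ j.+1)).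
  apply: approximableZ; apply: approximableB => //.
  have := @approximable_affine 1 h _ (oner_neq0 _) Aj.
  by congr approximable; apply/funext => x; rewrite mul1r.
by move=> x; rewrite [h^-1 * _]mulrC; exact: hC.
Qed.

Lemma approximable_ramp : (0 < k)%N ->
  approximable (fun x => Num.max x 0 ^+ k) -> approximable (fun x => Num.max x 0).
Proof.
move=> k0 Ak.
(* Descending induction on the exponent; i = k - 1 gives the ramp. *)
suff H i : (i < k)%N -> approximable (fun x => Num.max x 0 ^+ (k - i)).
  have := H k.-1; rewrite ltn_predL => /(_ k0).
  by rewrite -[in (k - _)%N](prednK k0) subSnn.
elim: i => [|i IH] ik; first by rewrite subn0.
apply: approximable_step_down; first by lia.
have -> : (k - i.+1).+1 = (k - i)%N by lia.
by apply: IH; lia.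
Qed.

(** * From the ramp to piecewise linear functions and functions that are o(|x|^k) *)

Section ramp.
Hypothesis ramp : approximable (fun x => Num.max x 0).

(** A difference of two ramps: it is 0 before [a], 1 after [a + d], and linear in between. *)
Lemma approximable_clamp (a d : R) : 0 < d ->
  approximable (fun x => Num.max ((x - a) / d) 0 - Num.max ((x - a) / d - 1) 0).
Proof.
move=> d0; have d1 : d^-1 != 0 by rewrite invr_neq0 ?gt_eqF.
apply: approximableB.
  have := @approximable_affine d^-1 (- (a / d)) _ d1 ramp.
  by congr approximable; apply/funext => x; congr Num.max; ring.
have := @approximable_affine d^-1 (- (a / d) - 1) _ d1 ramp.
by congr approximable; apply/funext => x; congr Num.max; ring.
Qed.

Lemma approximable_cst (c : R) : approximable (fun=> c).
Proof.
have Ac := @approximable_clamp 0 1 ltr01.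
have N10 : -1 != 0 :> R by rewrite oppr_eq0 oner_eq0.
have := approximableZ c _ (approximableD _ _ Ac (@approximable_affine (-1) 1 _ N10 Ac)).
congr approximable; apply/funext => x.
rewrite -[RHS]mulr1; congr *%R.
rewrite !subr0 !divr1.
have -> : -1 * x + 1 - 1 = - x by ring.
have -> : -1 * x + 1 = - (x - 1) by ring.
(* 1 = x_+ - (x - 1)_+ + (1 - x)_+ - (- x)_+ *)
have maxN (y : R) : Num.max y 0 - Num.max (- y) 0 = y.
  by case: (leP y 0) => y0; [rewrite (max_idPl _)|rewrite (max_idPr _)]; lra.
have := maxN x; have := maxN (x - 1); lra.
Qed.

Lemma clamp_cases (t : R) : let c := Num.max t 0 - Num.max (t - 1) 0 in
  [/\ 0 <= c <= 1, t <= 0 -> c = 0 & 1 <= t -> c = 1].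
Proof.
by rewrite /=; case: (leP t 0); case: (leP (t - 1) 0) => *; split => [||*]; lra.
Qed.

(** Induction on the number of cells: the previous interpolant is constant past its last node, so a
    clamp starting there, of height the increment of [g], adds one cell without disturbing the
    others. *)
Lemma approximable_interpolation g (a d e : R) (n : nat) : 0 < d ->
  (forall x y, a <= x <= a + n%:R * d -> `|x - y| <= d -> `|g x - g y| <= e) ->
  exists2 p, approximable p &
    [/\ forall x : R, x <= a -> p x = g a,
        forall x : R, a + n%:R * d <= x -> p x = g (a + n%:R * d) &
        forall x, a <= x <= a + n%:R * d -> `|g x - p x| <= e].
Proof.
move=> d0; elim: n => [|n IH] ge.
  exists (fun=> g a); first exact: approximable_cst.
  split=> // [x _|x xa]; first by rewrite mul0r addr0.
  by apply: ge => //; rewrite distrC ger0_norm; lra.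
set b := a + n%:R * d in IH *.
have bE : a + n.+1%:R * d = b + d by rewrite /b -natr1; ring.
have ab : a <= b by rewrite lerDl mulr_ge0 // ltW.
rewrite bE in ge *.
have [|p Ap [pa pb pab]] := IH.
  by move=> x y /andP[ax xb]; apply: ge; lra.
pose c x := Num.max ((x - b) / d) 0 - Num.max ((x - b) / d - 1) 0.
exists (fun x => (g (b + d) - g b) * c x + p x).
  by apply: approximable_comb => //; exact: approximable_clamp.
have c0 x : x <= b -> c x = 0.
  move=> xb; have [_ + _] := clamp_cases ((x - b) / d); apply.
  by rewrite pmulr_lle0 ?invr_gt0//; lra.
have c1 x : b + d <= x -> c x = 1.
  move=> xb; have [_ _] := clamp_cases ((x - b) / d); apply.
  by rewrite ler_pdivlMr//; lra.
have c01 x : 0 <= c x <= 1 by have [] := clamp_cases ((x - b) / d).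
split.
- by move=> x xa; rewrite c0 ?mulr0 ?add0r ?pa//; lra.
- by move=> x xb; rewrite c1// pb; lra.
move=> x /andP[ax xb].
have [xb'|bx] := leP x b; first by rewrite c0// mulr0 add0r pab// ax.
rewrite pb ?(ltW bx)//.
have g1 : `|g x - g b| <= e by apply: ge; rewrite ?ger0_norm; lra.
have g2 : `|g x - g (b + d)| <= e by apply: ge; rewrite ?ler0_norm; lra.
have /andP[c0x c1x] := c01 x.
(* On the new cell the interpolant is a convex combination of the two nodal values, each within [e]
   of [g x]. *)
have -> : g x - ((g (b + d) - g b) * c x + g b) =
  (1 - c x) * (g x - g b) + c x * (g x - g (b + d)) by ring.
have c1x' : 0 <= 1 - c x by rewrite subr_ge0.
apply: le_trans (ler_normD _ _) _.
rewrite !normrM (ger0_norm c0x) (ger0_norm c1x').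
have := ler_wpM2l c0x g2; have := ler_wpM2l c1x' g1; lra.
Qed.

(** Interpolate on [-M, M]. Beyond it the interpolant is frozen at g(M) or g(-M), and both that
    value and [g x] are at most e times [weight k x], hence the factor 2. *)
Lemma approximable_vanishing g : continuous g ->
  (forall e, 0 < e -> exists M, forall x, M <= `|x| -> `|g x| <= e * weight k x) ->
  approximable g.
Proof.
move=> cg gM; apply: (@approximable_lim 2) => e /andP[e0 _].
have [M0 gM0] := gM e e0.
(* [M0 <= M] makes the tail bound valid at the endpoints; [1 <= M] keeps the mesh positive. *)
pose M := Num.max M0 1.
have M1 : 1 <= M by rewrite le_max lexx orbT.
have [d d0 ud] := @segment_unif_continuous R g (- M) M e cg e0.
pose n := (Num.trunc (2 * M / d)).+1.
have n0 : 0 < n%:R :> R by rewrite ltr0n.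
have nM : - M + n%:R * (2 * M / n%:R) = M by field; rewrite gt_eqF.
have d'0 : 0 < 2 * M / n%:R by rewrite divr_gt0//; lra.
have d'd : 2 * M / n%:R < d.
  rewrite ltr_pdivrMr// [ltRHS]mulrC -ltr_pdivrMr//.
  exact: truncnS_gt.
have [|p Ap [pl pr pm]] := @approximable_interpolation g (- M) _ e n d'0.
  by rewrite nM => x y xM xy; apply/ltW/ud => //; exact: le_lt_trans d'd.
rewrite nM in pr pm.
exists p => // x.
have [xM|xM] := leP `|x| M.
  have w1 := @weight_ge1 R k x.
  apply: le_trans (pm x _) _; first by rewrite -ler_norml.
  have := ler_wpM2l (ltW e0) w1; lra.
have M0M : M0 <= M by rewrite le_max lexx.
have tail (y : R) : `|y| = M -> `|g x - g y| <= 2 * e * weight k x.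
  move=> yM; apply: le_trans (ler_normB _ _) _.
  have gx := gM0 x (ltac:(lra)).
  have gy := gM0 y (ltac:(rewrite yM//)).
  have wxy : weight k y <= weight k x by apply: le_weight; rewrite yM ltW.
  have := ler_wpM2l (ltW e0) wxy; lra.
have aM : `|M| = M by rewrite ger0_norm; lra.
move: xM; rewrite lter_normr => /orP[xM|xM].
  by rewrite pr ?(ltW xM)//; exact: tail.
by rewrite pl ?tail ?normrN//; lra.
Qed.
End ramp.

(** * From [sigma] to truncated powers and to all real functions of the space *)

(** The defining limits control x_+^k - sigma(x) for large |x| and compactness bounds it elsewhere
    by a constant, which rescaling divides by a^k. *)
Lemma approximable_truncpow : (0 < k)%N -> sigmoidal k sigma ->
  approximable (fun x => Num.max x 0 ^+ k).
Proof.
move=> k0 [cs sNy sy].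
have tail e : 0 < e -> exists2 M, 0 < M &
    forall y, M <= `|y| -> `|Num.max y 0 ^+ k - sigma y| <= e * `|y| ^+ k.
  move=> e0.
  have /cvgrPdist_lt/(_ e e0)[A [_ HA]] := sy.
  have /cvgrPdist_lt/(_ e e0)[B [_ HB]] := sNy.
  exists (1 + `|A| + `|B|) => [|y]; first by rewrite -addrA ltr_pwDl ?addr_ge0.
  have := ler_norm A; have := ler_norm (- B); rewrite normrN.
  have := normr_ge0 A; have := normr_ge0 B => *.
  have [y0|y0] := leP 0 y.
    have Ay : A < y by move: (ger0_norm y0); lra.
    have y0' : 0 < y by move: (ger0_norm y0); lra.
    have := HA y Ay; rewrite (ger0_norm y0) => h.
    rewrite -ler_pdivrMr ?exprn_gt0// -[X in _ / X]ger0_norm ?exprn_ge0//.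
    by rewrite -normf_div mulrBl divff ?(ltW h)// gt_eqF ?exprn_gt0.
  have By : y < B by move: (ltr0_norm y0); lra.
  have := HB y By; rewrite !sub0r expr0n gtn_eqF// sub0r !normrN => h.
  have ny : 0 < `|y| by rewrite normr_gt0 lt_eqF.
  by rewrite -ler_pdivrMr ?exprn_gt0// -normrX -normf_div ltW.
apply: (@approximable_lim 1) => e /andP[e0 e1].
have [M M0 HM] := tail e e0.
have MM : - M <= M by lra.
have cn : continuous (fun y => `|sigma y|).
  by move=> y; apply: continuous_comp; [exact: cs|exact: norm_continuous].
have [c _ hc] := @EVT_max R (fun y => `|sigma y|) (- M) M MM (continuous_subspaceT cn).
pose C := `|sigma c| + M ^+ k.
have C0 : 0 <= C by rewrite addr_ge0// exprn_ge0// ltW.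
have HC y : `|Num.max y 0 ^+ k - sigma y| <= e * `|y| ^+ k + C.
  have [yM|yM] := leP M `|y|; first by rewrite -[leLHS]addr0 lerD// HM.
  rewrite -[leLHS]add0r lerD ?mulr_ge0 ?exprn_ge0 ?(ltW e0)//.
  apply: le_trans (ler_normB _ _) _; rewrite addrC lerD//.
    by apply: hc; rewrite in_itv/= -ler_norml ltW.
  rewrite normrX lerXn2r ?nnegrE ?(ltW M0)//.
  by move: yM; rewrite ltr_norml; case: (leP y 0) => ? /andP[]; rewrite ?normr0 ?gtr0_norm//; lra.
(* Chosen so that C <= e a <= e a^k, the last step by [1 <= a] and [0 < k]; the total error is then
   e |x|^k + e, exactly e times the weight. *)
pose a := 1 + C / e.
have a1 : 1 <= a by rewrite lerDl divr_ge0 ?(ltW e0).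
have a0 : 0 < a by lra.
have ak0 : 0 < a ^+ k by rewrite exprn_gt0.
exists (fun x => (a ^+ k)^-1 * sigma (a * x + 0)).
  apply: approximableZ; apply: Hspan_approximable; apply: lspan_incl.
  by exists a, 0; rewrite gt_eqF.
move=> x; rewrite addr0 mul1r.
have -> : Num.max x 0 ^+ k - (a ^+ k)^-1 * sigma (a * x) =
    (Num.max (a * x) 0 ^+ k - sigma (a * x)) / a ^+ k.
  have -> : Num.max (a * x) 0 = a * Num.max x 0.
    by rewrite maxr_pMr ?mulr0 ?(ltW a0).
  rewrite exprMn mulrBl.
  by rewrite [_^-1 * _]mulrC [a ^+ k * _]mulrC mulfK ?gt_eqF.
rewrite normf_div (gtr0_norm ak0) ler_pdivrMr//.
apply: le_trans (HC _) _.
rewrite normrM (gtr0_norm a0) exprMn /weight.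
have : C <= e * a ^+ k.
  rewrite mulrC -ler_pdivrMr//; apply: (@le_trans _ _ a); first by rewrite /a; lra.
  by rewrite -[leLHS]expr1 ler_weXn2l.
nra.
Qed.

(** Replacing the weight by x^k costs only the constant [l], absorbed because the weight is at least
    [x] there. *)
Lemma tail_leading_term g (l : R) : (0 < k)%N ->
  g x / weight k x @[x --> +oo] --> l ->
  forall e, 0 < e -> exists M,
    forall x, M <= x -> `|g x - l * x ^+ k| <= e * weight k x.
Proof.
move=> k0 gl e e0; have e20 : 0 < e / 2 by rewrite divr_gt0.
have /cvgrPdist_lt/(_ _ e20)[A [_ HA]] := gl.
exists (1 + `|A| + `|l| / (e / 2)) => x.
have le0 : 0 <= `|l| / (e / 2) by rewrite divr_ge0// ltW.
have := ler_norm A; have := normr_ge0 A => An A0 Mx.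
have w0 := @weight_gt0 R k x.
have x1 : 1 <= x by lra.
have : `|g x - l * weight k x| <= e / 2 * weight k x.
  have -> : g x - l * weight k x = (g x / weight k x - l) * weight k x.
    by rewrite mulrBl divfK// gt_eqF.
  rewrite normrM (gtr0_norm w0) ler_wpM2r ?(ltW w0)// distrC ltW//.
  by apply: HA; lra.
have xw : x <= weight k x.
  apply: le_trans (norm_exp_le_weight k x); rewrite ger0_norm; last lra.
  by rewrite -[leLHS]expr1 ler_weXn2l.
have lw : `|l| <= e / 2 * weight k x.
  by rewrite mulrC -ler_pdivrMr//; lra.
have -> : g x - l * x ^+ k = g x - l * weight k x + l.
  by rewrite /weight ger0_norm; [ring|lra].
have := ler_normD (g x - l * weight k x) l; lra.
Qed.

Lemma approximable_continuous g (l m : R) : (0 < k)%N -> sigmoidal k sigma ->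
  continuous g ->
  g x / weight k x @[x --> +oo] --> l ->
  g x / weight k x @[x --> -oo] --> m ->
  approximable g.
Proof.
move=> k0 sP cg gl gm.
have At := approximable_truncpow k0 sP.
have N10 : -1 != 0 :> R by rewrite oppr_eq0 oner_eq0.
have AtN : approximable (fun x => Num.max (- x) 0 ^+ k).
  have := @approximable_affine (-1) 0 _ N10 At.
  by congr approximable; apply/funext => x; rewrite mulN1r addr0.
pose t x := l * Num.max x 0 ^+ k + m * Num.max (- x) 0 ^+ k.
have At' : approximable t by apply: approximable_comb => //; exact: approximableZ.
suff A0 : approximable (fun x => g x - t x).
  have := approximableD _ _ A0 At'.
  by congr approximable; apply/funext => x; rewrite subrK.
apply: approximable_vanishing.
- exact: approximable_ramp.
- have cmax : continuous (fun x : R => Num.max x 0 ^+ k).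
    have -> : (fun x : R => Num.max x 0 ^+ k) = (fun x => (2^-1 * (x + `|x|)) ^+ k).
      apply/funext => x; congr (_ ^+ _).
      by case: (leP x 0) => x0; [rewrite ler0_norm|rewrite gtr0_norm]; lra.
    move=> x; apply: (@continuous_comp _ _ _ (fun x : R => 2^-1 * (x + `|x|)) (fun y => y ^+ k));
      last exact: exprn_continuous.
    apply: cvgM; first exact: cvg_cst.
    by apply: cvgD; [exact: cvg_id|exact: norm_continuous].
  move=> x; apply: cvgB; first exact: cg.
  apply: cvgD; apply: cvgM; try exact: cvg_cst; first exact: cmax.
  apply: (@continuous_comp _ _ _ (fun y : R => - y) (fun y => Num.max y 0 ^+ k));
    first exact: opp_continuous.
  exact: cmax.
move=> e e0.
have [A HA] := @tail_leading_term g l k0 gl e e0.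
have gm' : g (- x) / weight k x @[x --> +oo] --> m.
  by move/cvgNy_compNP : gm; under eq_fun do rewrite /= weightN.
have [B HB] := @tail_leading_term (fun x => g (- x)) m k0 gm' e e0.
exists (1 + `|A| + `|B|) => x.
have := ler_norm A; have := ler_norm B.
have := normr_ge0 A; have := normr_ge0 B => *.
have k0' : (k == 0)%N = false by rewrite gtn_eqF.
rewrite /t; have [x0|x0] := leP 0 x.
  have xA : A <= x by move: (ger0_norm x0); lra.
  rewrite (max_idPr _) ?oppr_le0// expr0n k0' mulr0 addr0.
  exact: HA.
have xB : B <= - x by move: (ltr0_norm x0); lra.
rewrite (max_idPl _) ?oppr_ge0 ?(ltW x0)// expr0n k0' mulr0 add0r.
by have := HB (- x) xB; rewrite opprK weightN.
Qed.
End approximation.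

(** * Continuity of the passage between real and complex values *)

Section real_complex_continuity.
Local Open Scope complex_scope.
Context {R : realType}.

Lemma continuous_real_complex : continuous (fun x : R => x%:C : R[i]^o).
Proof.
move=> x; apply/(@cvgrPdist_lt _ _ _ (nbhs x)) => e.
rewrite ltcE => /andP[/eqP/= e1 e0].
have /cvgrPdist_lt/(_ _ e0) : id @ x --> x by exact: cvg_id.
apply: filterS => y /= xy.
by rewrite -rmorphB/= normc_def/= expr0n addr0 sqrtr_sqr ltcE/= e1 eqxx.
Qed.

Lemma continuous_Re : continuous (@complex.Re R : R[i]^o -> R).
Proof.
move=> z; apply/(@cvgrPdist_lt _ _ _ (nbhs (z : R[i]^o))) => e e0.
have e0' : 0 < e%:C :> R[i] by rewrite ltcR.
have : \forall w \near nbhs (z : R[i]^o), ball_ Num.norm z e%:C w.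
  by apply/nbhs_ballP; exists e%:C => // w; rewrite -ball_normE.
apply: filterS => w; rewrite /ball_/=; rewrite -ltcR; apply: le_lt_trans.
have := normc_ge_Re (z - w).
by case: z => a b; case: w => c d.
Qed.
End real_complex_continuity.

(** * The span lies in the weighted space *)

Section ridge_in_Y.
Context {R : realType} (k : nat) (sigma : R -> R).
Hypothesis (k_gt0 : (0 < k)%N).
Hypothesis (sigmaP : sigmoidal k sigma).

Lemma ridge_cvgy (a b : R) : a != 0 ->
  exists l : R, sigma (a * x + b) / weight k x @[x --> +oo] --> l.
Proof.
move=> a0; have [_ sNy sy] := sigmaP.
have invy : (fun x : R => x^-1) x @[x --> +oo] --> (0 : R).
  by apply/gtr0_cvgV0; [by apply: nbhs_pinfty_gt; exact: num_real|exact: cvg_id].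
have ratio : (fun x : R => a + b * x^-1) x @[x --> +oo] --> a.
  rewrite -[X in _ --> X]addr0 -[X in a + X](mulr0 b).
  by apply: cvgD; [exact: cvg_cst|apply: cvgM; [exact: cvg_cst|exact: invy]].
have wy : (weight k : R -> R) x @[x --> +oo] --> +oo.
  apply/cvgryPge => A; near=> x.
  apply: (@le_trans _ _ x).
    by near: x; apply: nbhs_pinfty_ge; exact: num_real.
  apply: le_trans (norm_exp_le_weight k x).
  have x1 : 1 <= x by near: x; apply: nbhs_pinfty_ge; exact: num_real.
  rewrite ger0_norm; last by lra.
  by rewrite -[leLHS]expr1 ler_weXn2l.
have invw : (weight k x)^-1 @[x --> +oo] --> (0 : R).
  by apply/gtr0_cvgV0 => //; apply: nearW => x; exact: weight_gt0.
have xw : (1 - (weight k x)^-1) @[x --> +oo] --> (1 : R).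
  rewrite -[X in _ --> X]subr0.
  by apply: cvgB; [exact: cvg_cst|exact: invw].
have [l sl] : exists l : R, sigma (a * x + b) / (a * x + b) ^+ k @[x --> +oo] --> l.
  have [a_gt0|a_le0] := ltP 0 a.
    exists 1; apply: (@cvg_comp _ _ _ (fun x => a * x + b)
      (fun y => sigma y / y ^+ k) _ +oo); last exact: sy.
    apply/cvgryPge => A.
    apply: filterS (nbhs_pinfty_ge (num_real (a^-1 * (A - b)))) => x.
    by rewrite ler_pdivrMl// lerBlDr.
  exists 0; apply: (@cvg_comp _ _ _ (fun x => a * x + b)
    (fun y => sigma y / y ^+ k) _ -oo); last exact: sNy.
  apply/cvgrNyPle => A.
  have an : a < 0 by rewrite lt_neqAle a0.
  apply: filterS (nbhs_pinfty_ge (num_real (a^-1 * (A - b)))) => x.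
  by rewrite ler_ndivrMl// lerBrDr.
(* With y = a x + b, the quotient factors for large x as (sigma(y) / y^k) (a + b/x)^k (1 - 1/w),
   where w is the weight and 1 - 1/w = x^k / w. *)
exists (l * a ^+ k * 1).
have prodE : sigma (a * x + b) / (a * x + b) ^+ k * (a + b * x^-1) ^+ k *
    (1 - (weight k x)^-1) @[x --> +oo] --> l * a ^+ k * 1.
  apply: cvgM; last exact: xw.
  apply: cvgM; first exact: sl.
  apply: (@cvg_comp _ _ _ (fun x => a + b * x^-1) (fun y => y ^+ k) _ (nbhs a)).
    exact: ratio.
  exact: exprn_continuous.
apply: cvg_trans prodE; apply: near_eq_cvg.
(* Past this threshold both [x] and [a * x + b] are nonzero. *)
apply: filterS (nbhs_pinfty_gt (num_real (Num.max 1 (- b / a)))) => x.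
rewrite gt_max => /andP[x1 xba].
have x0 : x != 0 by rewrite gt_eqF//; lra.
have y0 : a * x + b != 0.
  apply/eqP => /eqP; rewrite addr_eq0 => /eqP axb.
  suff : x < x by rewrite ltxx.
  have {1}-> : x = - b / a by rewrite -axb mulrC mulKf.
  exact: xba.
have w0 : weight k x != 0 by rewrite gt_eqF ?weight_gt0.
have -> : a + b * x^-1 = (a * x + b) / x by field.
have -> : 1 - (weight k x)^-1 = x ^+ k / weight k x.
  have -> : x ^+ k = weight k x - 1 by rewrite /weight ger0_norm; [ring|lra].
  by rewrite mulrBl divff// mul1r.
rewrite expr_div_n.
field.
by rewrite w0 !expf_neq0.
Unshelve. all: by end_near.
Qed.

Lemma ridge_inY (a b : R) : a != 0 -> inY k (ridge sigma a b).
Proof.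
move=> a0; have [cs _ _] := sigmaP.
have lim (F : set_system R) (c : R -> R) (l : R) : Filter F ->
    c x / weight k x @[x --> F] --> l ->
    exists l : R[i]^o, weighted k (fun x => (c x)%:C%C : R[i]^o) x @[x --> F] --> l.
  move=> FF cl; exists (l%:C)%C.
  rewrite /weighted; under eq_fun do rewrite -fmorphV -rmorphM/=.
  exact: (cvg_comp _ _ cl (@continuous_real_complex R l)).
split.
- move=> x.
  apply: (@continuous_comp _ _ _ (fun x => sigma (a * x + b)) (fun y => y%:C%C : R[i]^o));
    last exact: continuous_real_complex.
  apply: (@continuous_comp _ _ _ (fun x => a * x + b) sigma); last exact: cs.
  apply: cvgD; last exact: cvg_cst.
  by apply: cvgM; [exact: cvg_cst|exact: cvg_id].
- by have [l] := ridge_cvgy a b a0; exact: lim.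
(* The limit at -oo is the limit at +oo of the reflected ridge, of slope [- a]. *)
- have Na0 : - a != 0 by rewrite oppr_eq0.
  have [l al] := ridge_cvgy (- a) b Na0.
  apply: lim; apply/cvgNy_compNP.
  move: al; rewrite /comp; under eq_fun do rewrite mulNr -mulrN -(weightN k).
  exact.
Qed.

Lemma Hspan_inY : Hspan sigma `<=` inY k.
Proof.
move=> f [n [c [u [Hu ->]]]].
suff : \sum_(i < n) c i *: u i \in Ymem (R:=R) k by move/asboolP.
apply: rpred_sum => i _; apply: rpredZ.
by have [a [b [a0 ->]]] := Hu i; apply/asboolP; exact: ridge_inY.
Qed.
End ridge_in_Y.

(** * Complex functions and density *)

Section density.
Local Open Scope complex_scope.
Context {R : realType} (k : nat) (sigma : R -> R).
Hypothesis (k_gt0 : (0 < k)%N) (sigmaP : sigmoidal k sigma).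

Lemma approximable_Re (f : R -> R[i]^o) :
  inY k f -> approximable k sigma (fun x => complex.Re (f x)).
Proof.
move=> [cf [l fl] [m fm]].
have wRe x : complex.Re (f x) / weight k x = complex.Re (weighted k f x).
  by rewrite /weighted -fmorphV/=; case: (f x) => u v /=; rewrite mulr0 subr0.
have lim (F : set_system R) (c : R[i]^o) : Filter F ->
    weighted k f x @[x --> F] --> c ->
    complex.Re (f x) / weight k x @[x --> F] --> complex.Re c.
  move=> FF fc; under eq_fun do rewrite wRe.
  exact: (cvg_comp _ _ fc (@continuous_Re R c)).
apply: (@approximable_continuous R k sigma _ _ _ k_gt0 sigmaP _ (lim _ _ _ fl) (lim _ _ _ fm)).
move=> x; apply: (@continuous_comp _ _ _ f (@complex.Re R : R[i]^o -> R)); first exact: cf.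
exact: continuous_Re.
Qed.

Lemma Hspan_approx_inY (f : R -> R[i]^o) (e : R) : inY k f -> 0 < e ->
  exists2 h, Hspan sigma h & Ynorm k (f - h) <= e.
Proof.
move=> fY e0; have e20 : 0 < e / 2 by rewrite divr_gt0.
(* Im z = Re (- 'i * z) *)
have iY : inY k ((- 'i : R[i]) *: f).
  suff : (- 'i : R[i]) *: f \in Ymem (R:=R) k by move/asboolP.
  by apply: rpredZ; apply/asboolP.
have [h1 H1 fh1] := approximable_Re _ fY _ e20.
have [h2 H2 fh2] := approximable_Re _ iY _ e20.
exists ((fun x => (h1 x)%:C : R[i]^o) + ('i : R[i]) *: (fun x => (h2 x)%:C : R[i]^o)).
  by apply: lspanD => //; exact: lspanZ.
apply: Ynorm_le => x; rewrite ler_pdivrMr ?weight_gt0//.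
have ReN : complex.Re (((- 'i : R[i]) *: f) x) = complex.Im (f x).
  change (complex.Re (- 'i * f x) = complex.Im (f x)).
  by case: (f x) => u v /=; ring.
have := fh1 x; have := fh2 x; rewrite ReN.
set r := complex.Re _ - _; set s := complex.Im _ - _ => sh rh.
have -> : (f - ((fun x => (h1 x)%:C : R[i]^o) + ('i : R[i]) *: (fun x => (h2 x)%:C : R[i]^o))) x
    = r%:C + 'i * s%:C.
  change (f x - ((h1 x)%:C + 'i * (h2 x)%:C) = r%:C + 'i * s%:C).
  by rewrite [f x]complexE /r /s !rmorphB mulrBr opprD addrACA.
apply: le_trans (le_normcD _ _) _.
have nC (t : R) : Normc.normc t%:C = `|t|.
  by rewrite /= expr0n addr0 sqrtr_sqr.
rewrite Normc.normcM !nC.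
have -> : Normc.normc ('i : R[i]) = 1 by rewrite /= expr0n expr1n add0r sqrtr1.
rewrite mul1r; lra.
Qed.
End density.

Theorem theorem1p3 (R : realType) (k : nat) (sigma : R -> R)
  (k_gt0 : (0 < k)%N) (sigmaP : sigmoidal k sigma) :
  Hspan sigma `<=` inY k /\
  dense [set f : Yspace R k | Hspan sigma f].
Proof.
have HY : Hspan sigma `<=` inY k by exact: Hspan_inY.
split=> // O [f Of] oO.
have /nbhs_ballP[e /= e0 fe] : nbhs f O by rewrite nbhsE; exists O.
(* The radius lives in [R[i]]; its positivity says that it is real with positive real part. *)
move: e0; rewrite ltcE => /andP[/eqP/= e1 e0].
(* Half the radius, since the approximation bound is weak and the ball is strict. *)
have e20 : 0 < complex.Re e / 2 by rewrite divr_gt0.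
have [h Hh fh] := Hspan_approx_inY k sigma k_gt0 sigmaP f _ (YP f) e20.
have hY : h \in Ymem (R:=R) k by apply/asboolP; exact: HY.
exists (MkYspace hY); split => //.
apply: fe; rewrite -ball_normE /ball_/= YnormE ltcE/= e1 eqxx/=.
apply: le_lt_trans fh _; lra.
Qed.
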